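(* Let $T$ be the tournament on vertex set $\{v_1,v_2,v_3,v_4,v_5\}$ with arcs $$(v_1,v_2),(v_2,v_3),(v_3,v_4),(v_4,v_5),(v_5,v_1),(v_1,v_3),(v_1,v_4),(v_2,v_5),(v_3,v_5),(v_4,v_2).$$ Then $T$ is strongly connected, $\chi(T)=5$, and $T$ contains no 2-block cycle $c(4,1)$. In particular, the following question has a negative answer (for $k=4$, $\ell=1$): if $D$ is an $n$-chromatic strongly connected digraph with $n\ge 4$, and $k,\ell$ are positive integers with $k+\ell=n$, must $D$ contain a 2-block cycle $c(k,\ell)$?
   Context: Digraphs are simple: no loops and no multiple arcs, but a pair of opposite arcs is allowed. Paths and cycles in a digraph are always directed; the length of a path is its number of arcs. A digraph is strongly connected if for any two vertices $u,v$ there are a path from $u$ to $v$ and a path from $v$ to $u$. $\chi(D)$ is the chromatic number of the underlying simple graph of $D$, and $D$ is $n$-chromatic if $\chi(D)=n$. For positive integers $k,\ell$, a 2-block cycle $c(k,\ell)$ is an orientation of an undirected cycle which consists of two internally vertex-disjoint directed paths, of lengths at least $k$ and at least $\ell$ respectively, from one vertex to another vertex; a digraph contains a $c(k,\ell)$ if some subdigraph of it is of this form. *)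

(* Defs.v *)
From mathcomp Require Import all_boot.
Set Implicit Arguments.
Unset Strict Implicit.
Unset Printing Implicit Defensive.

(* Finite simple digraphs: arcs form an irreflexive relation, so there are
   no loops and no multiple arcs, but opposite arcs are allowed. *)
Record digraph := Digraph {
  vertex :> finType;
  has_arc : rel vertex;
  has_arc_irr : irreflexive has_arc
}.

Record sgraph := SGraph {
  svertex :> finType;
  edge : rel svertex;
  edge_sym : symmetric edge;
  edge_irr : irreflexive edge
}.

Definition underlying_edge (D : digraph) : rel D :=
  [rel x y | has_arc x y || has_arc y x].

Lemma underlying_sym (D : digraph) : symmetric (@underlying_edge D).
Proof. by move=> x y; exact: orbC. Qed.

Lemma underlying_irr (D : digraph) : irreflexive (@underlying_edge D).
Proof. by move=> x; rewrite /underlying_edge /= !has_arc_irr. Qed.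

Definition underlying (D : digraph) : sgraph :=
  SGraph (@underlying_sym D) (@underlying_irr D).

Definition colorable (G : sgraph) (k : nat) : bool :=
  [exists f : {ffun G -> 'I_k}, [forall x, forall y, edge x y ==> (f x != f y)]].

Lemma colorable_ex (G : sgraph) : exists k, colorable G k.
Proof.
exists #|G|; apply/existsP; exists [ffun x => enum_rank x].
apply/forallP=> x; apply/forallP=> y; apply/implyP=> exy; rewrite !ffunE.
by apply: contraTneq exy => /enum_rank_inj ->; rewrite edge_irr.
Qed.

Definition chromatic_number (G : sgraph) : nat := ex_minn (colorable_ex G).

Definition chi (D : digraph) : nat := chromatic_number (underlying D).

(* The path with vertex sequence x :: p, whose length is size p. *)
Definition dipath (D : digraph) (x y : D) (p : seq D) : bool :=
  [&& path (@has_arc D) x p, last x p == y & uniq (x :: p)].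

Definition path_arcs (D : digraph) (x : D) (p : seq D) : seq (D * D) :=
  zip (x :: p) p.

Definition strongly_connected (D : digraph) : Prop :=
  forall x y : D, exists p, dipath x y p.

Definition tournament (D : digraph) : Prop :=
  forall x y : D, x != y -> has_arc x y (+) has_arc y x.

(* s lists the vertices of the cycle in cyclic order. *)
Definition is_cycle (G : sgraph) : Prop :=
  exists s : seq G,
    [/\ 3 <= size s, uniq s, (forall x, x \in s)
      & forall x y, edge x y = (y == next s x) || (x == next s y)].

Definition oriented_cycle (D : digraph) : Prop :=
  is_cycle (underlying D) /\ forall x y : D, has_arc x y -> ~~ has_arc y x.

Definition internally_disjoint (D : digraph) (x y : D) (p q : seq D) : Prop :=
  forall z, z \in x :: p -> z \in x :: q -> z = x \/ z = y.

(* The digraph D itself is a c(k,l).  The last clause says that D consists of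
   the two paths. *)
Definition two_block_cycle (k l : nat) (D : digraph) : Prop :=
  oriented_cycle D /\
  exists (x y : D) (p q : seq D),
    [/\ x != y,
        dipath x y p /\ dipath x y q,
        internally_disjoint x y p q,
        k <= size p /\ l <= size q
      & forall u v, has_arc u v = ((u, v) \in path_arcs x p ++ path_arcs x q)].

(* C is isomorphic to a (not necessarily induced) subdigraph of D. *)
Definition subdigraph (C D : digraph) : Prop :=
  exists f : C -> D, injective f /\ {homo f : u v / has_arc u v}.

Definition contains_two_block_cycle (k l : nat) (D : digraph) : Prop :=
  exists2 C : digraph, subdigraph C D & two_block_cycle k l C.

Definition two_block_question (k l : nat) : Prop :=
  forall (D : digraph) (n : nat),
    chi D = n -> strongly_connected D -> 4 <= n ->
    0 < k -> 0 < l -> k + l = n ->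
    contains_two_block_cycle k l D.

Definition T_arcs : seq (nat * nat) :=
  [:: (1, 2); (2, 3); (3, 4); (4, 5); (5, 1);
      (1, 3); (1, 4); (2, 5); (3, 5); (4, 2)].

(* The vertex v_i is the element of 'I_5 with value i - 1. *)
Definition T_arc : rel 'I_5 := fun x y => (x.+1, y.+1) \in T_arcs.

Lemma T_arc_irr : irreflexive T_arc.
Proof. by case; do 5?[case=> //]. Qed.

Definition T : digraph := Digraph T_arc_irr.

(* Main.v *)
Require Import Defs.
From mathcomp Require Import all_boot.

(** In a tournament any two vertices are adjacent, so a proper colouring is
    injective and the chromatic number is the number of vertices
    ([chi_tournament]).  The closed walk v1 v2 v3 v4 v5 v1 visits every vertex
    of [T], so [T] is strongly connected ([strongly_connected_of_cycle]).

    In a digraph on five vertices, the long block of a [c(4,1)] already uses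
    every vertex, so the other block has no internal vertex and is a single
    arc: some Hamiltonian path from x to y is accompanied by the arc (x, y)
    ([two_block_spanning_path]).  No Hamiltonian path of [T] has such a chord
    ([T_spanning_path_no_chord]).  As [T] is a strongly connected tournament
    on 4 + 1 vertices, it answers the question in the negative. *)

Lemma colorable_card (G : sgraph) : colorable G #|G|.
Proof.
apply/existsP; exists (finfun enum_rank); apply/forallP=> x; apply/forallP=> y.
rewrite !ffunE (inj_eq enum_rank_inj).
by case: eqP => [->|]; rewrite ?edge_irr ?implybT.
Qed.

Lemma chi_tournament (D : digraph) : tournament D -> chi D = #|D|.
Proof.
move=> tourD; rewrite /chi /chromatic_number; case: ex_minnP => m col_m min_m.
apply/eqP; rewrite eqn_leq (min_m _ (colorable_card _)) /=.
case/existsP: col_m => f /forallP proper_f.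
have inj_f : injective f.
  move=> x y fxy; apply/eqP; case: eqVneq => //= neq_xy.
  have /forallP/(_ y) := proper_f x; rewrite fxy eqxx implybF /= negb_or.
  case/andP=> /negbTE no_xy /negbTE no_yx.
  by have := tourD _ _ neq_xy; rewrite no_xy no_yx.
by rewrite -[leqRHS]card_ord; apply: leq_card inj_f.
Qed.

Lemma strongly_connected_of_cycle (D : digraph) (s : seq D) :
  cycle (@has_arc D) s -> (forall x, x \in s) -> strongly_connected D.
Proof.
move=> cyc_s all_s x y.
have /connectP[p path_p ->] := connect_cycle cyc_s (all_s x) (all_s y).
case/shortenP: path_p => q path_q uniq_q _.
by exists q; rewrite /dipath path_q eqxx uniq_q.
Qed.

(** The long block has at least n + 1 vertices, hence is spanning; the vertices
    of the other block after x then lie on it, so by internal disjointness they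
    are all equal to y. *)
Lemma two_block_spanning_path (D : digraph) (n : nat) :
  #|D| = n.+1 -> contains_two_block_cycle n 1 D ->
  exists (x : D) (p : seq D),
    [/\ path (@has_arc D) x p, uniq (x :: p), size p = n
      & has_arc x (last x p)].
Proof.
move=> cardD [C [f [inj_f hom_f]] [_ [x [y [p [q]]]]]].
case=> _ [/and3P[path_p /eqP last_p uniq_p] /and3P[path_q /eqP last_q uniq_q]].
move=> disj_pq [le_n_p lt_0_q] _.
have uniq_fp : uniq (f x :: map f p) by rewrite -map_cons map_inj_uniq.
have cardC : #|C| <= n.+1 by rewrite -cardD; apply: leq_card inj_f.
have card_p : #|x :: p| = (size p).+1 by rewrite (card_uniqP uniq_p).
have size_p : size p = n.
  by apply/eqP; rewrite eqn_leq le_n_p -ltnS -card_p (leq_trans (max_card _)).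
have span_p z : z \in x :: p.
  have /eqP eq_card : #|x :: p| == #|C|.
    by rewrite eqn_leq max_card card_p size_p.
  by have /(_ z)-> := subset_cardP eq_card (subset_predT _).
exists (f x), (map f p); split; rewrite ?size_map //.
  by rewrite path_map; apply: sub_path path_p => u v; apply: hom_f.
rewrite last_map last_p; apply: hom_f.
case: q lt_0_q path_q uniq_q disj_pq {last_q} => //= z q _ /andP[arc_xz _].
case/andP=> x_notin _ /(_ z (span_p z)) disj_z.
case: disj_z => [|eq_zx|<- //]; first by rewrite !inE eqxx orbT.
by rewrite eq_zx inE eqxx in x_notin.
Qed.

(** The arcs of [T] on the labels 0, ..., 4 of its vertices, so that statements
    about [T] can be evaluated on sequences of natural numbers. *)
Definition T_label_arc : rel nat := fun i j => (i.+1, j.+1) \in T_arcs.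

Lemma tournament_T : tournament T.
Proof.
by move=> [[|[|[|[|[|i]]]]] ltx] [[|[|[|[|[|j]]]]] lty].
Qed.

Lemma strongly_connected_T : strongly_connected T.
Proof.
apply: (@strongly_connected_of_cycle T (enum 'I_5)) => [|x].
  have -> : @has_arc T = relpre val T_label_arc by [].
  by rewrite -cycle_map val_enum_ord.
exact: mem_enum.
Qed.

(** The only arc out of v5 and the only arc into v1 is (v5, v1).  On a
    Hamiltonian path from x to y with a chord (x, y), this arc must be used:
    otherwise v5 is the last vertex and v1 the first one, and (v1, v5) is not an
    arc.  Moreover x is not v5 and y is not v1, since the chord would be
    (v5, v1), whose ends are consecutive on the path and not its two ends.
    Deleting v5 and v1 leaves x, z, y in this order with
    {x, z, y} = {v2, v3, v4}, and either (x, z) or (z, y) is an arc of the path.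
    The tournament on these three vertices is the directed 3-cycle v2 v3 v4,
    where one such arc forces (y, x) to be an arc, against the chord.  The proof
    evaluates the claim on the 120 orderings of the vertices. *)
Lemma T_spanning_path_no_chord (x : T) (p : seq T) :
  path (@has_arc T) x p -> uniq (x :: p) -> size p = 4 ->
  ~~ has_arc x (last x p).
Proof.
move=> path_p uniq_p size_p.
have no_chord : all (fun s => sorted T_label_arc s ==>
    ~~ T_label_arc (head 0 s) (last 0 s)) (permutations (iota 0 5)).
  by vm_compute.
have perm_p : map val (x :: p) \in permutations (iota 0 5).
  rewrite mem_permutations; apply: uniq_perm; rewrite ?iota_uniq //.
    by rewrite (map_inj_uniq val_inj).
  apply: (uniq_min_size _ _ _).2; rewrite ?(map_inj_uniq val_inj) //.
    by move=> _ /mapP[z _ ->]; rewrite mem_iota ltn_ord.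
  by rewrite size_iota size_map /= size_p.
have /implyP := allP no_chord _ perm_p.
by rewrite /= last_map path_map; apply.
Qed.

Theorem mainTheorem3 :
  [/\ tournament T,
      strongly_connected T,
      chi T = 5
    & ~ contains_two_block_cycle 4 1 T] /\
  [/\ ~ two_block_question 4 1
    & ~ (forall k l : nat, two_block_question k l)].
Proof.
have chiT : chi T = 5 by rewrite (chi_tournament _ tournament_T) card_ord.
have no_c41 : ~ contains_two_block_cycle 4 1 T.
  case/two_block_spanning_path=> [|x [p [path_p uniq_p size_p]]].
    exact: card_ord.
  exact/negP/T_spanning_path_no_chord.
have no41 : ~ two_block_question 4 1.
  by move=> /(_ T 5 chiT strongly_connected_T) c41; apply/no_c41/c41.
split; split.
- exact: tournament_T.
- exact: strongly_connected_T.
- exact: chiT.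
- exact: no_c41.
- exact: no41.
- by move=> question; apply/no41/question.
Qed.
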